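(* Let $G_0$ be a bipartite PMH-graph of order $2n$ with bipartition $U=\{u_i : i\in\{1,\dots,n\}\}$ and $V=\{v_i : i\in\{1,\dots,n\}\}$, for some $n>1$. Let $\mathcal{I}\subseteq\{i : \deg(v_i)=3\}$. For each $i\in\mathcal{I}$, let $G_i$ be a graph (not necessarily bipartite) admitting a 3-malleable vertex $z_i$. Then the graph $G$ obtained by applying a star product on $v_i$ and $z_i$, for each $i\in\mathcal{I}$, is PMH.
   Context: Graphs are finite and connected, may have multiple (parallel) edges, and have no loops; the degree $\deg(v)$ of a vertex $v$ is the number of edges incident to it. A perfect matching is the edge set of a $1$-regular spanning subgraph, and a Hamiltonian cycle is a connected $2$-regular spanning subgraph. A Hamiltonian cycle $H$ extends a perfect matching $M$ if $M\subseteq E(H)$. A graph admitting a perfect matching is PMH if each of its perfect matchings can be extended to a Hamiltonian cycle. For a vertex $v$, $\partial v$ denotes the set of edges incident to $v$. If $G$ admits a perfect matching and $v$ is a vertex of degree $t\ge 2$, then $v$ is $t$-malleable if for every perfect matching $M$ of $G$ there exist Hamiltonian cycles $H_1,\dots,H_{t-1}$ of $G$, all extending $M$, such that $\partial v - M\subset \bigcup_{i=1}^{t-1}E(H_i)$. Star product: let $v\in V(G)$, $z\in V(G')$ be vertices of degree 3 in vertex-disjoint graphs, with incident edges $va_1,va_2,va_3$ and $zb_1,zb_2,zb_3$ respectively. A star product on $v$ and $z$ is the graph $(G-v)\cup(G'-z)\cup\{a_1b_1,a_2b_2,a_3b_3\}$ (for any choice of the ordering of the neighbours). It is assumed that neither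 $G$ nor $G'$ is the cubic graph on two vertices (three parallel edges). Applying a star product on $v_i$ and $z_i$ for each $i\in\mathcal{I}$ means applying these star products successively, starting from $G_0$, each on the vertex $v_i$ of the current graph and the vertex $z_i$ of $G_i$ (each with any choice of ordering of the neighbours). *)

(* Defs.v *)
From mathcomp Require Import all_boot.

Set Implicit Arguments.
Unset Strict Implicit.
Unset Printing Implicit Defensive.

(* Finite loopless multigraphs: distinct elements of [edge G] may have the same
   set of ends. *)
Record mgraph := MGraph {
  vertex : finType;
  edge : finType;
  ends : edge -> {set vertex};
  card_ends : forall e, #|ends e| = 2
}.

Section Multigraph.
Variable G : mgraph.
Implicit Types (x y v : vertex G) (e : edge G) (F M H : {set edge G}).

Definition boundary v : {set edge G} := [set e | v \in ends e].

Definition degree v : nat := #|boundary v|.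

(* A spanning subgraph is identified with its edge set [F]. *)
Definition regular_subgraph (k : nat) F : Prop :=
  forall v, #|boundary v :&: F| = k.

Definition adjacent F : rel (vertex G) :=
  fun x y => [exists e in F, ends e == [set x; y]].

Definition connected_subgraph F : Prop := forall x y, connect (adjacent F) x y.

Definition connected : Prop := connected_subgraph [set: edge G].

Definition perfect_matching M : Prop := regular_subgraph 1 M.

Definition hamiltonian_cycle H : Prop :=
  connected_subgraph H /\ regular_subgraph 2 H.

Definition extends H M : Prop := hamiltonian_cycle H /\ M \subset H.

Definition PMH : Prop :=
  (exists M, perfect_matching M) /\
  (forall M, perfect_matching M -> exists H, extends H M).

Definition malleable (t : nat) v : Prop :=
  [/\ 2 <= t,
      degree v = t,
      exists M, perfect_matching M
    & forall M, perfect_matching M ->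
        exists H : 'I_t.-1 -> {set edge G},
          (forall i, extends (H i) M) /\
          boundary v :\: M \subset \bigcup_i H i].

Definition bipartition (A B : {set vertex G}) : Prop :=
  [/\ A :|: B = [set: vertex G],
      [disjoint A & B]
    & forall e, exists x y, [/\ x \in A, y \in B & ends e = [set x; y]]].

(* Looplessness forces the three edges to be parallel. *)
Definition cubic_on_two_vertices : Prop :=
  #|vertex G| = 2 /\ forall v, degree v = 3.

End Multigraph.

(* The orderings of the edges v a_1, v a_2, v a_3 and z b_1, z b_2, z b_3 are the
   maps [a] and [b]; they are meant to be bijective, which is required where
   [star] is used. *)
Section StarProduct.
Variables (G G' : mgraph) (v : vertex G) (z : vertex G').
Variables (a : 'I_3 -> {e : edge G | e \in boundary v}).
Variables (b : 'I_3 -> {e : edge G' | e \in boundary z}).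

Definition star_vertex : finType :=
  ({x : vertex G | x != v} + {y : vertex G' | y != z})%type.

Definition star_edge : finType :=
  ({e : edge G | v \notin ends e} + {e : edge G' | z \notin ends e} + 'I_3)%type.

(* The edge [inr i] joins the end of [a i] other than [v] to the end of [b i]
   other than [z]. *)
Definition star_ends (e : star_edge) : {set star_vertex} :=
  match e with
  | inl (inl e1) => [set inl x | x in [set x | val x \in ends (val e1)]]
  | inl (inr e2) => [set inr y | y in [set y | val y \in ends (val e2)]]
  | inr i => [set inl x | x in [set x | val x \in ends (val (a i))]] :|:
             [set inr y | y in [set y | val y \in ends (val (b i))]]
  end.

Lemma card_sub_ends (K : mgraph) (w : vertex K) (e : edge K) :
  #|[set x : {x : vertex K | x != w} | val x \in ends e]| = 2 - (w \in ends e).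
Proof.
have <- : #|ends e :\ w| = 2 - (w \in ends e).
  by rewrite -(card_ends e) (cardsD1 w (ends e)) addKn.
rewrite -(card_imset _ val_inj); apply: eq_card => y.
apply/imsetP/setD1P => [[x + ->] | [yw ye]]; first by rewrite inE (valP x).
by exists (exist _ y yw); rewrite ?inE.
Qed.

Lemma card_star_ends (e : star_edge) : #|star_ends e| = 2.
Proof.
have injl : injective (@inl {x : vertex G | x != v} {y : vertex G' | y != z}).
  by move=> ? ? [].
have injr : injective (@inr {x : vertex G | x != v} {y : vertex G' | y != z}).
  by move=> ? ? [].
case: e => [[e|e]|i] /=.
- by rewrite (card_imset _ injl) card_sub_ends (negbTE (valP e)).
- by rewrite (card_imset _ injr) card_sub_ends (negbTE (valP e)).
rewrite cardsU disjoint_setI0.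
  rewrite (card_imset _ injl) (card_imset _ injr) !card_sub_ends cards0.
  by have:= valP (a i); have:= valP (b i); rewrite !inE => -> ->.
by apply/pred0P => p /=; apply/andP => -[/imsetP[x _ ->] /imsetP[y _]].
Qed.

Definition star : mgraph := MGraph card_star_ends.

End StarProduct.

(* [star_products Gs z G w s H]: starting from [G], star products on [w i] and
   [z i] are applied successively for the indices [i] listed in [s], and the
   graph obtained is [H].  [w i] is the current vertex with index [i], or [None]
   once a star product has removed it. *)
Inductive star_products (n : nat) (Gs : 'I_n -> mgraph)
    (z : forall i, vertex (Gs i)) :
    forall G : mgraph, ('I_n -> option (vertex G)) -> seq 'I_n -> mgraph -> Prop :=
| star_products_nil G w : @star_products n Gs z G w [::] G
| star_products_cons G w i s (v : vertex G)
    (a : 'I_3 -> {e : edge G | e \in boundary v})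
    (b : 'I_3 -> {e : edge (Gs i) | e \in boundary (z i)}) H :
    w i = Some v ->
    bijective a ->
    bijective b ->
    ~ cubic_on_two_vertices G ->
    ~ cubic_on_two_vertices (Gs i) ->
    @star_products n Gs z (star a b)
      (fun j => omap inl (obind insub (w j))) s H ->
    @star_products n Gs z G w (i :: s) H.

(* Main.v *)
Require Import Defs.
From mathcomp Require Import all_boot.

(* Let [G] arise from [G_0] by replacing the vertices [v_i].  Each [v_i] becomes
   an odd class of vertices, only joined to [U], so a perfect matching [M] of [G]
   has an edge leaving each of the [n] classes.  As [U] has [n] vertices, exactly
   one edge of [M] leaves each class, and [M] induces perfect matchings of the
   factors of a star product.  Extend the matching of the first factor to a
   Hamiltonian cycle; it uses exactly one further edge at [v_i], and
   3-malleability provides a Hamiltonian cycle of the second factor which extends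
   its matching and uses the corresponding edge at [z_i].  The two cycles glue.

   Connectivity is handled by cuts: by parity a Hamiltonian cycle has at least
   two edges in each cut, so it still crosses every cut after the deletion of a
   vertex. *)

Set Implicit Arguments.
Unset Strict Implicit.
Unset Printing Implicit Defensive.

(** * Edge cuts, parity and Hamiltonian cycles *)

Section Cuts.
Variable G : mgraph.
Implicit Types (x y v : vertex G) (e : edge G) (S : {set vertex G}).
Implicit Types (F M H : {set edge G}).

Definition crossing S : {set edge G} := [set e | #|ends e :&: S| == 1].

Lemma ends_other e x : x \in ends e -> exists2 y, y != x & ends e = [set x; y].
Proof.
move=> xe; have:= card_ends e; rewrite (cardsD1 x) xe => -[] /eqP/cards1P[y ey].
have: y \in ends e :\ x by rewrite ey set11.
by rewrite in_setD1 => /andP[yx _]; exists y; rewrite // -ey setD1K.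
Qed.

Lemma crossingP S e :
  reflect (exists x y, [/\ x \in ends e, y \in ends e, x \in S & y \notin S])
    (e \in crossing S).
Proof.
rewrite inE; apply: (iffP idP) => [/cards1P[x exS] | [x [y [xe ye xS yS]]]].
  have: x \in ends e :&: S by rewrite exS set11.
  rewrite inE => /andP[xe xS]; have [y yx eE] := ends_other xe.
  exists x, y; rewrite xe xS eE !inE eqxx orbT; split=> //.
  apply/negP => yS; have: y \in ends e :&: S by rewrite eE !inE eqxx orbT.
  by rewrite exS inE (negbTE yx).
have [t tx eE] := ends_other xe; rewrite {}eE in ye *.
have {ye tx} -> : t = y.
  by move: ye; rewrite !inE => /orP[]/eqP // yx; rewrite yx xS in yS.
apply/cards1P; exists x; apply/setP => u; rewrite !inE.
have [->|_] := eqVneq u x; first by rewrite xS.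
by have [->|] := eqVneq u y; rewrite ?(negbTE yS).
Qed.

Lemma crossingC S : crossing (~: S) = crossing S.
Proof.
apply/setP => e; apply/crossingP/crossingP => -[x [y [xe ye]]].
  by rewrite !inE negbK => xS yS; exists y, x.
by move=> xS yS; exists y, x; rewrite !inE negbK.
Qed.

(** If no edge of [F] left [S], then [S] would be closed under adjacency; conversely, the cut
    condition is applied to the component of [x]. *)
Lemma connected_crossing F :
  connected_subgraph F <->
  forall S x y, x \in S -> y \notin S -> exists2 e, e \in F & e \in crossing S.
Proof.
split=> [conF S x y xS yS | cutF x y].
  apply/exists_inP; apply: contraNT yS => /exists_inPn noF.
  rewrite -(@closed_connect _ (adjacent F) (mem S) _ x y) // => p q.
  case/existsP=> e /andP[eF /eqP epq]; have enS := noF e eF.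
  have [pe qe] : p \in ends e /\ q \in ends e by rewrite epq !inE !eqxx orbT.
  apply/idP/idP => hS; apply: contraNT enS => hN; apply/crossingP;
    [by exists p, q | by exists q, p].
apply: contraT => nxy.
pose S := [set p | connect (adjacent F) x p].
have [||e eF /crossingP[p [q [pe qe]]]] := cutF S x y.
- by rewrite inE connect0.
- by rewrite inE.
rewrite !inE => pS /negP[]; have [t tp eE] := ends_other pe.
move: qe; rewrite eE !inE => /orP[]/eqP-> //.
by apply: connect_trans pS (connect1 _); apply/exists_inP; exists e; rewrite ?eE.
Qed.

Lemma cardsI_sum (T : finType) (A B : {set T}) :
  #|A :&: B| = \sum_(x in B) (x \in A).
Proof.
rewrite -sum1_card big_mkcond [RHS]big_mkcond; apply: eq_bigr => x _.
by rewrite inE; case: (x \in A); case: (x \in B).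
Qed.

Lemma sum_boundary S F :
  \sum_(x in S) #|boundary x :&: F| = \sum_(e in F) #|ends e :&: S|.
Proof.
under eq_bigr => x _ do rewrite cardsI_sum.
under [RHS]eq_bigr => e _ do rewrite cardsI_sum.
rewrite exchange_big; apply: eq_bigr => e _; apply: eq_bigr => x _.
by rewrite inE.
Qed.

(** Modulo 2, the edges with both ends in [S] cancel in the double count [sum_boundary]. *)
Lemma odd_crossing S F :
  odd #|crossing S :&: F| = odd (\sum_(x in S) #|boundary x :&: F|).
Proof.
rewrite sum_boundary cardsI_sum !(big_morph odd oddD (erefl _)).
apply: eq_bigr => e _; rewrite inE.
have: #|ends e :&: S| <= 2 by rewrite -(card_ends e) subset_leq_card ?subsetIl.
by case: #|_| => [|[|[|]]].
Qed.

Lemma odd_crossing_matching S M :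
  perfect_matching M -> odd #|crossing S :&: M| = odd #|S|.
Proof.
move=> pmM; rewrite odd_crossing -sum1_card.
by under eq_bigr => x _ do rewrite pmM.
Qed.

Lemma crossingT : crossing setT = set0.
Proof. by apply/setP => e; rewrite !inE setIT card_ends. Qed.

Lemma perfect_matching_even M : perfect_matching M -> ~~ odd #|vertex G|.
Proof.
by move=> pmM; rewrite -cardsT -(odd_crossing_matching _ pmM) crossingT set0I cards0.
Qed.

Lemma matching_boundary M v e :
  perfect_matching M -> e \in boundary v -> e \in M -> boundary v :&: M = [set e].
Proof.
move=> pmM ev eM; apply/esym/eqP.
by rewrite eqEcard pmM cards1 sub1set in_setI ev eM.
Qed.

Lemma hamiltonian_crossing H S x y :
  hamiltonian_cycle H -> x \in S -> y \notin S -> 1 < #|crossing S :&: H|.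
Proof.
case=> conH regH xS yS.
have [e eH eS] := (connected_crossing H).1 conH S x y xS yS.
have : ~~ odd #|crossing S :&: H|.
  rewrite odd_crossing; under eq_bigr => t _ do rewrite regH.
  by rewrite sum_nat_const oddM andbF.
have: 0 < #|crossing S :&: H| by apply/card_gt0P; exists e; rewrite in_setI eS.
by case: #|_| => [|[|]].
Qed.

(** Expresses that [H] minus [v] is connected. Otherwise the edges of [H] crossing [S], at least
    two, would be exactly the two at [v], and likewise for the complement of [v |: S]; but an edge
    from [v] into [S] does not cross the latter. *)
Lemma hamiltonian_crossing_off H v S x y :
    hamiltonian_cycle H -> x \in S -> v \notin S -> y != v -> y \notin S ->
  exists e, [/\ e \in H, v \notin ends e & e \in crossing S].
Proof.
move=> hamH xS vS yv yS.
have [/exists_inP[e eH /andP[]]|/exists_inPn noE] :=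
  boolP [exists e in H, (v \notin ends e) && (e \in crossing S)]; first by exists e.
have bdE (T : {set vertex G}) p q : p \in T -> q \notin T ->
    (forall e, e \in H -> v \notin ends e -> e \notin crossing T) ->
  crossing T :&: H = boundary v :&: H.
  move=> pT qT noT; apply/eqP; rewrite eqEcard; apply/andP; split.
    apply/subsetP => e /setIP[eT eH]; rewrite !in_setI eH andbT inE.
    by apply: contraLR eT; apply: noT.
  by case: (hamH) => _ ->; apply: hamiltonian_crossing pT qT.
have noS e : e \in H -> v \notin ends e -> e \notin crossing S.
  by move=> /noE + ve; rewrite ve.
have crS := bdE S x v xS vS noS.
have crT : crossing (~: (v |: S)) :&: H = boundary v :&: H.
  apply: (bdE _ y v) => [||e eH ve]; rewrite ?crossingC ?inE ?eqxx ?negb_or ?yv //.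
  have := noS e eH ve; rewrite !inE.
  suff -> : ends e :&: (v |: S) = ends e :&: S by [].
  by apply/setP => t; rewrite !inE; have [->|//] := eqVneq t v; rewrite (negbTE ve).
have [e] : exists e, e \in boundary v :&: H.
  by apply/card_gt0P; case: (hamH) => _ ->.
move=> eB; have := eB; rewrite -{1}crS => /setIP[eS _].
have := eB; rewrite -{1}crT => /setIP[eT _].
have := eB; rewrite !inE => /andP[ve _].
have [t tv eE] := ends_other ve.
have tS : t \in S.
  case/crossingP: eS => p [q [pe _ pS _]]; move: pe; rewrite eE !inE.
  by case/orP=> /eqP pE; move: pS; rewrite pE // (negbTE vS).
case/crossingP: eT => p [q [pe _ + _]]; move: pe; rewrite eE !inE.
by case/orP=> /eqP ->; rewrite ?eqxx ?tS ?orbT.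
Qed.

Lemma hamiltonian_matching_complement H M :
  extends H M -> perfect_matching M -> perfect_matching (H :\: M).
Proof.
move=> [[_ regH] MH] pmM x.
have := regH x; rewrite -(cardsID M) -setIA (setIidPr MH) pmM => -[].
by rewrite setIDA.
Qed.

Lemma extension_boundary H M v e :
    extends H M -> perfect_matching M -> e \in boundary v -> e \in H -> e \notin M ->
  boundary v :&: H = e |: boundary v :&: M.
Proof.
move=> [[_ regH] MH] pmM ev eH eM; apply/esym/eqP.
rewrite eqEcard regH cardsU1 pmM in_setI (negbTE eM) andbF andbT.
by rewrite subUset sub1set in_setI ev eH setIS.
Qed.

(** Malleability covers both unmatched edges at [z], so one of the cycles contains the prescribed
    [e]. *)
Lemma malleable3_extension z M e :
    malleable 3 z -> perfect_matching M -> e \in boundary z :\: M ->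
  exists2 H, extends H M & boundary z :&: H = e |: boundary z :&: M.
Proof.
case=> _ _ _ mal pmM ez; have [H [extH subH]] := mal M pmM.
have /bigcupP[i _ eH] := subsetP subH e ez; exists (H i) => //.
by move: ez; rewrite inE => /andP[eM ez]; apply: extension_boundary.
Qed.

(** If [M] misses [e], a Hamiltonian cycle [H] extending [M] through [e] splits into [M] and
    [H :\: M], and the latter is a matching through [e]. *)
Lemma malleable3_matching z e :
  malleable 3 z -> e \in boundary z -> exists2 M, perfect_matching M & e \in M.
Proof.
move=> mal ez; have [_ _ [M pmM] _] := mal.
have [eM|eM] := boolP (e \in M); first by exists M.
have [|H extH bdH] := malleable3_extension mal pmM (e := e).
  by rewrite inE eM.
exists (H :\: M); first exact: hamiltonian_matching_complement.
have : e \in boundary z :&: H by rewrite bdH !inE eqxx.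
by rewrite !inE eM => /andP[].
Qed.

End Cuts.

(** * A graph minus a vertex as a part of a larger graph *)

Section Side.
Variables (G K : mgraph) (v : vertex G).
Variables (j : {x : vertex G | x != v} -> vertex K) (l : edge G -> edge K).

(* [G - v] is a part of [K], the edges at [v] being prolonged to edges of [K]
   that leave this part. *)
Definition side : Prop :=
  [/\ injective l,
      forall x e, (j x \in ends (l e)) = (val x \in ends e)
    & forall x e', j x \in ends e' -> e' \in codom l].

Hypothesis sideP : side.

Lemma side_boundary x (F : {set edge K}) :
  #|boundary (j x) :&: F| = #|boundary (val x) :&: l @^-1: F|.
Proof.
have [linj lE lK] := sideP; rewrite -(card_imset _ linj).
apply: eq_card => e'; apply/setIP/imsetP => [[] | [e + ->]].
  rewrite inE => xe' e'F; have /codomP[e e'E] := lK _ _ xe'.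
  by exists e => //; rewrite !inE -lE -e'E xe'.
by rewrite !inE lE => /andP.
Qed.

(** The vertex [v] has no image under [j], so its degree is a separate hypothesis. *)
Lemma side_regular k (F : {set edge K}) :
    #|boundary v :&: l @^-1: F| = k ->
  (forall x, #|boundary (j x) :&: F| = k) <-> regular_subgraph k (l @^-1: F).
Proof.
move=> vk; split=> [Fk x | Fk x]; last by rewrite side_boundary Fk.
have [->|xv] := eqVneq x v; first exact: vk.
by rewrite -(Fk (Sub x xv)) side_boundary SubK.
Qed.

(** A set [S] splitting the part would pull back to a set that avoids [v]; by
    [hamiltonian_crossing_off] the cycle crosses it away from [v], and the image of that edge
    crosses [S]. *)
Lemma side_uncut (F : {set edge K}) (S : {set vertex K}) x y :
    hamiltonian_cycle (l @^-1: F) ->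
    (forall e, e \in F -> e \notin crossing S) ->
  (j x \in S) = (j y \in S).
Proof.
move=> hamF noF; have [linj lE lK] := sideP.
suff sub p q : j p \in S -> j q \in S by apply/idP/idP; apply: sub.
move=> pS; apply: contraT => qS.
pose S1 := [set val p | p in j @^-1: S].
have jS1 t : (val t \in S1) = (j t \in S).
  by rewrite mem_imset ?inE //; apply: val_inj.
have [||||e [eF ve /crossingP[s [t [se te sS tS]]]]] :=
    hamiltonian_crossing_off (v := v) (S := S1) (x := val p) (y := val q) hamF.
- by rewrite jS1.
- by apply/negP => /imsetP[r _ vr]; have := valP r; rewrite /= -vr eqxx.
- exact: (valP q).
- by rewrite jS1.
have sv : s != v by apply: contraNneq ve => <-.
have tv : t != v by apply: contraNneq ve => <-.
rewrite inE in eF; case/negP: (noF _ eF); apply/crossingP.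
by exists (j (Sub s sv)), (j (Sub t tv)); rewrite !lE -!jS1 !SubK.
Qed.

End Side.

(** * Maps on edges that treat the edges at a vertex separately *)

Section Lift.
Variables (G : mgraph) (v : vertex G) (a : 'I_3 -> {e : edge G | e \in boundary v}).
Hypothesis a_bij : bijective a.
Variables (T : Type) (inner : {e : edge G | v \notin ends e} -> T) (cut : 'I_3 -> T).

(* The last branch is never reached. *)
Definition lift_edge (e : edge G) : T :=
  if [pick k | val (a k) == e] is Some k then cut k else
  if insub e is Some e1 then inner e1 else cut ord0.

Lemma lift_edge_inner e : lift_edge (val e) = inner e.
Proof.
rewrite /lift_edge; case: pickP => [k /eqP ak|_]; last by rewrite valK.
by have := valP e; rewrite -ak; have := valP (a k); rewrite inE => ->.
Qed.

Lemma lift_edge_cut k : lift_edge (val (a k)) = cut k.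
Proof.
rewrite /lift_edge; case: pickP => [k' /eqP/val_inj|/(_ k)]; last by rewrite eqxx.
by move/(bij_inj a_bij) ->.
Qed.

Lemma boundary_cut e : e \in boundary v -> exists k, e = val (a k).
Proof.
by move=> ev; have [b _ bK] := a_bij; exists (b (Sub e ev)); rewrite bK SubK.
Qed.

Variant lift_edge_spec e : T -> Prop :=
| LiftInner e1 of e = val e1 : lift_edge_spec e (inner e1)
| LiftCut k of e = val (a k) : lift_edge_spec e (cut k).

Lemma lift_edgeP e : lift_edge_spec e (lift_edge e).
Proof.
have [/boundary_cut[k ->]|ve] := boolP (e \in boundary v).
  by rewrite lift_edge_cut; constructor.
rewrite inE in ve; have -> : e = val (Sub e ve : {e | v \notin ends e}) by rewrite SubK.
by rewrite lift_edge_inner; constructor.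
Qed.

Lemma card_boundary_cut (F : {set edge G}) :
  #|boundary v :&: F| = #|[set k | val (a k) \in F]|.
Proof.
have ainj : injective (fun k => val (a k)) by move=> k k' /val_inj/(bij_inj a_bij).
rewrite -(card_imset _ ainj); apply: eq_card => e.
apply/setIP/imsetP => [[/boundary_cut[k ->] kF]|[k + ->]]; first by exists k; rewrite ?inE.
by rewrite inE; split=> //; apply: valP.
Qed.

End Lift.

(** * Restriction to the factors of a star product, and gluing *)

Section Star.
Variables (G G' : mgraph) (v : vertex G) (z : vertex G').
Variables (a : 'I_3 -> {e : edge G | e \in boundary v}).
Variables (b : 'I_3 -> {e : edge G' | e \in boundary z}).
Hypotheses (a_bij : bijective a) (b_bij : bijective b).

Let K := star a b.
Let jl (x : {x | x != v}) : vertex K := inl x.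
Let jr (y : {y | y != z}) : vertex K := inr y.
Let cut (k : 'I_3) : edge K := inr k.
Let inl_edge (e : {e | v \notin ends e}) : edge K := inl (inl e).
Let inr_edge (e : {e | z \notin ends e}) : edge K := inl (inr e).
Let ll : edge G -> edge K := lift_edge a inl_edge cut.
Let lr : edge G' -> edge K := lift_edge b inr_edge cut.

Lemma mem_inl_ends x (e : edge K) :
  (jl x \in ends e) = match e with
  | inl (inl e1) => val x \in ends (val e1)
  | inl (inr _) => false
  | inr k => val x \in ends (val (a k))
  end.
Proof.
have injl : injective jl by move=> ? ? [].
case: e => [[e|e]|k] /=.
- by rewrite (mem_imset _ _ injl) inE.
- by apply/negbTE/imsetP => -[].
rewrite inE (mem_imset _ _ injl) inE orbC.
by case: imsetP => // -[].
Qed.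

Lemma mem_inr_ends y (e : edge K) :
  (jr y \in ends e) = match e with
  | inl (inl _) => false
  | inl (inr e1) => val y \in ends (val e1)
  | inr k => val y \in ends (val (b k))
  end.
Proof.
have injr : injective jr by move=> ? ? [].
case: e => [[e|e]|k] /=.
- by apply/negbTE/imsetP => -[].
- by rewrite (mem_imset _ _ injr) inE.
rewrite inE (mem_imset _ _ injr) inE.
by case: imsetP => // -[].
Qed.

Lemma side_inl : side jl ll.
Proof.
split=> [e e' | x e | x [[e|e]|k]]; rewrite ?mem_inl_ends //.
- by rewrite /ll; case: lift_edgeP => // ? ->; case: lift_edgeP => // ? -> [] ->.
- by rewrite /ll; case: lift_edgeP => // ? ->.
- by rewrite -[inl _]/(inl_edge e) -(lift_edge_inner a _ cut) codom_f.
by rewrite -[inr _]/(cut k) -(lift_edge_cut a_bij inl_edge) codom_f.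
Qed.

Lemma side_inr : side jr lr.
Proof.
split=> [e e' | x e | x [[e|e]|k]]; rewrite ?mem_inr_ends //.
- by rewrite /lr; case: lift_edgeP => // ? ->; case: lift_edgeP => // ? -> [] ->.
- by rewrite /lr; case: lift_edgeP => // ? ->.
- by rewrite -[inl _]/(inr_edge e) -(lift_edge_inner b _ cut) codom_f.
by rewrite -[inr _]/(cut k) -(lift_edge_cut b_bij inr_edge) codom_f.
Qed.

(** The condition for gluing, as [a k] and [b k] prolong to the same edge of the product. *)
Definition agree (F : {set edge G}) (F' : {set edge G'}) :=
  forall k, (val (a k) \in F) = (val (b k) \in F').

Lemma agree_preim (M : {set edge K}) : agree (ll @^-1: M) (lr @^-1: M).
Proof. by move=> k; rewrite !inE /ll /lr !lift_edge_cut. Qed.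

(** The union of the two images works: an edge of the product with preimages on both sides is a cut
    edge, where [F] and [F'] agree. *)
Lemma agree_glue F F' : agree F F' ->
  exists M : {set edge K}, F = ll @^-1: M /\ F' = lr @^-1: M.
Proof.
move=> ag; have [injl _ _] := side_inl; have [injr _ _] := side_inr.
exists (ll @: F :|: lr @: F'); split; apply/setP => e; rewrite !inE mem_imset //.
  have [//|eF] := boolP (e \in F); apply/esym/negbTE/imsetP => -[e' e'F].
  rewrite /ll /lr; case: lift_edgeP => // k eE; case: lift_edgeP => // k' e'E [kk].
  by move: eF; rewrite eE ag kk -e'E e'F.
rewrite orbC; have [//|eF] := boolP (e \in F').
apply/esym/negbTE/imsetP => -[e' e'F].
rewrite /ll /lr; case: lift_edgeP => // k eE; case: lift_edgeP => // k' e'E [kk].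
by move: eF; rewrite eE -ag kk -e'E e'F.
Qed.

(** The product has lost [v] and [z]; the degree of either in the preimage of [M] is the number of
    cut edges in [M]. *)
Lemma star_regular k (M : {set edge K}) : #|[set i | cut i \in M]| = k ->
  regular_subgraph k M <->
  regular_subgraph k (ll @^-1: M) /\ regular_subgraph k (lr @^-1: M).
Proof.
move=> Mk.
have Fv : #|boundary v :&: ll @^-1: M| = k.
  rewrite (card_boundary_cut a_bij) -Mk; apply: eq_card => i.
  by rewrite !inE /ll lift_edge_cut.
have Fz : #|boundary z :&: lr @^-1: M| = k.
  rewrite (card_boundary_cut b_bij) -Mk; apply: eq_card => i.
  by rewrite !inE /lr lift_edge_cut.
have [lr1 lr2] := side_regular side_inl Fv.
have [rr1 rr2] := side_regular side_inr Fz.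
split=> [regM|[/lr2 regl /rr2 regr] [x|y]].
- by split; [apply: lr1 => x | apply: rr1 => y]; apply: regM.
- exact: regl.
- exact: regr.
Qed.

Lemma star_hamiltonian (H : {set edge K}) :
  hamiltonian_cycle (ll @^-1: H) -> hamiltonian_cycle (lr @^-1: H) ->
  hamiltonian_cycle H.
Proof.
move=> hamF hamF'.
have H2 : #|[set i | cut i \in H]| = 2.
  case: hamF => _ /(_ v); rewrite (card_boundary_cut a_bij) => H2; rewrite -[RHS]H2.
  by apply: eq_card => i; rewrite !inE /ll lift_edge_cut.
split; last by apply/(star_regular H2); split; [case: hamF | case: hamF'].
apply/connected_crossing => S x y xS yS.
(* If no edge of [H] crosses [S], then [S] splits neither side, and a cut edge in [H] ties the two
   sides together. *)
apply/exists_inP; apply: contraNT yS => /exists_inPn noH.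
have [k kH] : exists k, cut k \in H.
  have /card_gt0P[k] : 0 < #|[set i | cut i \in H]| by rewrite H2.
  by rewrite inE; exists k.
have ck := noH _ kH.
have [s [t [s_k t_k]]] : exists s t, jl s \in ends (cut k) /\ jr t \in ends (cut k).
  have := valP (a k); have := valP (b k); rewrite !inE => /ends_other[t tz tE].
  case/ends_other=> s sv sE; exists (Sub s sv), (Sub t tz).
  by rewrite mem_inl_ends mem_inr_ends /= sE tE !inE !eqxx !orbT.
have st : (jl s \in S) = (jr t \in S).
  by apply/idP/idP => uS; apply: contraNT ck => nS; apply/crossingP;
    [exists (jl s), (jr t) | exists (jr t), (jl s)].
have inS p : (p \in S) = (jl s \in S).
  case: p => p; first exact: (side_uncut side_inl _ _ hamF noH).
  by rewrite st; exact: (side_uncut side_inr _ _ hamF' noH).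
by rewrite inS -(inS x).
Qed.

(** The last hypothesis makes both restrictions of [M] perfect matchings, as it fixes their degree
    at [v] and [z]; [barrier_crossing] will supply it. *)
Lemma star_PMH : PMH G -> malleable 3 z ->
    (forall M : {set edge K}, perfect_matching M -> #|[set i | cut i \in M]| = 1) ->
  PMH K.
Proof.
move=> [[M0 pmM0] extG] mal cut1; split=> [|M pmM].
  (* The matching [M0] determines the cut edge [k], and malleability of [z] gives a matching of [G']
     through [b k] to glue with it. *)
  have [e] : exists e, e \in boundary v :&: M0 by apply/card_gt0P; rewrite pmM0.
  rewrite in_setI => /andP[/(boundary_cut a_bij)[k {e}->] kM0].
  have [M' pmM' kM'] := malleable3_matching mal (valP (b k)).
  have M0v := matching_boundary pmM0 (valP (a k)) kM0.
  have M'z := matching_boundary pmM' (valP (b k)) kM'.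
  have ag : agree M0 M'.
    move=> i; transitivity (i == k).
      rewrite -(bij_eq a_bij) -(inj_eq val_inj) -in_set1 -M0v in_setI.
      by rewrite (valP (a i)).
    rewrite -(bij_eq b_bij) -(inj_eq val_inj) -in_set1 -M'z in_setI.
    by rewrite (valP (b i)).
  have [M [M0E M'E]] := agree_glue ag; exists M; apply/star_regular.
    have := pmM0 v; rewrite (card_boundary_cut a_bij) M0E => M01; rewrite -[RHS]M01.
    by apply: eq_card => i; rewrite !inE /ll lift_edge_cut.
  by rewrite -M0E -M'E.
have [pmF pmF'] := (star_regular (cut1 M pmM)).1 pmM.
have [H0 extH0] := extG _ pmF; have [hamH0 FH0] := extH0.
(* The second edge of [H0] at [v]: its index [k] dictates which edge at [z] the second cycle has to
   use. *)
have [e] : exists e, e \in (boundary v :&: H0) :\: ll @^-1: M.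
  apply/card_gt0P; have := cardsID (ll @^-1: M) (boundary v :&: H0).
  by rewrite -setIA (setIidPr FH0) pmF; case: hamH0 => _ ->; case: #|_|.
rewrite !in_setD in_setI => /and3P[eF /(boundary_cut a_bij)[k ek] eH0].
have agM := agree_preim M; rewrite {e}ek in eF eH0.
have [|H' [hamH' F'H'] zH'] := malleable3_extension mal pmF' (e := val (b k)).
  by rewrite in_setD -agM eF (valP (b k)).
have vH0 := extension_boundary extH0 pmF (valP (a k)) eH0 eF.
(* Each cycle uses, at the removed vertex, the matching edge and the edge of index [k]. *)
have ag : agree H0 H'.
  move=> i; have := congr1 (fun F : {set _} => val (a i) \in F) vH0.
  have := congr1 (fun F : {set _} => val (b i) \in F) zH'.
  rewrite !(in_setI, in_setU1) (valP (a i)) (valP (b i)) /= -agM => -> ->.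
  by rewrite !(inj_eq val_inj) (bij_eq a_bij) (bij_eq b_bij).
have [H [H0E H'E]] := agree_glue ag; rewrite H0E in hamH0 FH0; rewrite H'E in hamH' F'H'.
exists H; split; first exact: star_hamiltonian.
apply/subsetP => -[[e|e]|i] eM.
- have := subsetP FH0 (val e); rewrite !inE /ll lift_edge_inner; exact.
- have := subsetP F'H' (val e); rewrite !inE /lr lift_edge_inner; exact.
have := subsetP FH0 (val (a i)); rewrite !inE /ll lift_edge_cut //; exact.
Qed.

(** The hypotheses make [S] the side of [G'], which is left by the cut edges only. *)
Lemma card_star_cut (S : {set vertex K}) (M : {set edge K}) :
    (forall x, jl x \notin S) -> (forall y, jr y \in S) ->
  #|[set i | cut i \in M]| = #|crossing S :&: M|.
Proof.
move=> lS rS; have cut_inj : injective cut by move=> ? ? [].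
rewrite -(card_imset _ cut_inj); apply: eq_card => e.
apply/imsetP/setIP => [[k + ->] | []].
  rewrite inE; split=> //; apply/crossingP.
  have := valP (a k); have := valP (b k); rewrite !inE => /ends_other[t tz tE].
  case/ends_other=> s sv sE; exists (jr (Sub t tz)), (jl (Sub s sv)).
  by rewrite mem_inl_ends mem_inr_ends lS rS /= sE tE !inE !eqxx !orbT.
case/crossingP=> -[p|p] [[q|q] []]; last by rewrite -[inr q]/(jr q) rS.
- by move=> _ _ /idPn[]; apply: lS.
- by move=> _ _ /idPn[]; apply: lS.
rewrite -[inl q]/(jl q) -[inr p]/(jr p) mem_inl_ends mem_inr_ends.
by case: e => [[]|k] // _ _ _ _ kM; exists k; rewrite ?inE.
Qed.

End Star.

(** * Counting the matching edges that leave the odd classes *)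

Section Barrier.
Variables (n : nat) (G : mgraph) (f : vertex G -> option 'I_n).

(* The vertices of value [None] play the role of [U], and the vertices of value
   [Some i] are those that have replaced [v_i]. *)
Definition barrier : Prop :=
  [/\ #|[set x | f x == None]| = n,
      forall i, odd #|[set x | f x == Some i]|
    & forall e x y i j, x \in ends e -> y \in ends e ->
        f x = Some i -> f y = Some j -> i = j].

(** At least one edge of [M] leaves each class, by parity. Such an edge leaves only one class and
    has an end of value [None]; there are [n] such ends, each covered once, so the [n] counts sum to
    at most [n]. *)
Lemma barrier_crossing M i : barrier -> perfect_matching M ->
  #|crossing [set x | f x == Some i] :&: M| = 1.
Proof.
move=> [fN fodd fE] pmM; pose C i := crossing [set x | f x == Some i].
have C1 j : 0 < #|C j :&: M|.
  by have := odd_crossing_matching [set x | f x == Some j] pmM; rewrite fodd => /odd_gt0.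
have : \sum_j #|C j :&: M| <= n.
  apply: (@leq_trans (\sum_(e in M) #|ends e :&: [set x | f x == None]|)).
    under eq_bigr => j _ do rewrite cardsI_sum.
    rewrite exchange_big; apply: leq_sum => e _ /=.
    have [k eCk|noC] := pickP (fun j => e \in C j); last first.
      by rewrite big1 // => j _; rewrite noC.
    have [x [y [xe ye]]] := crossingP _ _ eCk; rewrite !inE => /eqP fx fy.
    have fy0 : f y = None.
      case fyj: (f y) fy => [j|] //.
      by rewrite (fE e y x j k ye xe fyj fx) eqxx.
    rewrite (bigD1 k) //= big1 => [|j jk].
      by rewrite addn0 eCk; apply/card_gt0P; exists y; rewrite !inE ye fy0.
    apply/eqP; rewrite eqb0; apply: contraNN jk => /crossingP[t [_ [te _ + _]]].
    by rewrite inE => /eqP ft; apply/eqP; apply: (fE e t x).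
  rewrite -sum_boundary; under eq_bigr => x _ do rewrite pmM.
  by rewrite sum1_card fN.
have nE : \sum_(j < n) 1 = n by rewrite sum1_card card_ord.
rewrite -[X in _ <= X]nE.
have [//|Ci] := eqVneq #|C i :&: M| 1.
(* A second edge leaving the class [i] would push the sum above [n]. *)
rewrite leqNgt (bigD1 i) //= [X in _ < X](bigD1 i) //= -addSn leq_add //.
  by rewrite ltn_neqAle eq_sym Ci C1.
by apply: leq_sum => j _; apply: C1.
Qed.

End Barrier.

(** * Induction along the successive star products *)

(** The invariant is a labelling [f] that is a barrier and in which each vertex given by [w] is
    alone in its class. *)
Lemma star_products_PMH n (Gs : 'I_n -> mgraph) (z : forall i, vertex (Gs i))
    (G : mgraph) (w : 'I_n -> option (vertex G)) (f : vertex G -> option 'I_n)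
    (s : seq 'I_n) (H : mgraph) :
    PMH G -> barrier f ->
    (forall i x y, w i = Some x -> (f y == Some i) = (y == x)) ->
    (forall i, i \in s -> malleable 3 (z i)) ->
    star_products z w s H ->
  PMH H.
Proof.
move=> pmhG fB wf mal sG; elim: sG f pmhG fB wf mal => {G w s H} //.
move=> G w i s v a b H wi a_bij b_bij _ _ _ IH f pmhG fB wf mal.
(* The vertices from [Gs i] inherit the label of [v], which they replace. *)
pose f' (p : vertex (star a b)) : option 'I_n := if p is inl x then f (val x) else Some i.
have fv : f v = Some i by apply/eqP; rewrite (wf _ _ _ wi).
have mali : malleable 3 (z i) by apply: mal; rewrite mem_head.
have [fN fodd fE] := fB.
have inl_inj : injective (fun x : {x | x != v} => inl x : vertex (star a b)).
  by move=> ? ? [].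
have inr_inj : injective (fun y : {y | y != z i} => inr y : vertex (star a b)).
  by move=> ? ? [].
have fibre o : o != Some i -> #|[set p | f' p == o]| = #|[set x | f x == o]|.
  move=> oi.
  have <- : [set (inl x : vertex (star a b)) | x in [set x : {x | x != v} | f (val x) == o]] =
     [set p | f' p == o].
    apply/setP => -[x|y]; first by rewrite mem_imset ?inE.
    by rewrite [RHS]inE /= eq_sym (negbTE oi); apply/negbTE/negP => /imsetP[].
  rewrite card_imset // -(card_imset _ val_inj); apply: eq_card => x.
  rewrite inE; apply/imsetP/eqP => [[t + ->]|fx]; first by rewrite inE => /eqP.
  have xv : x != v by apply: contraNneq oi => xv; rewrite -fx xv fv.
  by exists (Sub x xv); rewrite ?inE ?SubK ?fx.
have fB' : barrier f'.
  split=> [|j|e p q j k].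
  - by rewrite fibre.
  - have [->|ji] := eqVneq j i; last by rewrite fibre.
    have -> : [set p | f' p == Some i] =
        [set (inr y : vertex (star a b)) | y in {: {y | y != z i}}].
      apply/setP => -[x|y]; rewrite inE /=.
        by rewrite (wf _ _ _ wi) (negbTE (valP x)); apply/esym/negbTE/negP => /imsetP[].
      by rewrite eqxx mem_imset.
    (* The new class has one vertex less than [Gs i], whose order is even because it has a perfect
       matching. *)
    rewrite card_imset // card_sig cardC1.
    case: mali => _ _ [M /perfect_matching_even] + _.
    have : 0 < #|vertex (Gs i)| by apply/card_gt0P; exists (z i).
    by case: #|_| => [|m] //= _; rewrite negbK.
  case: p => [x|y]; case: q => [x'|y'] //=; rewrite ?mem_inl_ends ?mem_inr_ends.
  + by case: e => [[e|//]|c]; apply: fE.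
  (* An edge between the two sides prolongs [a c], which joins [x] to [v] in [G]; the barrier
     property of [f] is applied to that edge. *)
  + case: e => [[//|//]|c] xc yc fx [<-].
    apply: (fE _ _ _ _ _ xc) fx fv.
    by have := valP (a c); rewrite inE.
  + case: e => [[//|//]|c] yc xc [<-] fx.
    apply: (fE _ _ _ _ _ _ xc) fv fx.
    by have := valP (a c); rewrite inE.
  by move=> _ _ [<-] [<-].
apply: (IH f') => //.
(* The cut edges are those that leave the new class [i] of the product. *)
- apply: star_PMH => // M pmM; apply: etrans (barrier_crossing i fB' pmM).
  apply: card_star_cut => [x|y]; rewrite inE /= ?eqxx //.
  by rewrite (wf _ _ _ wi) (valP x).
- move=> j p q; case wj: (w j) => [y|] //=; case: insubP => //= x yv xy [<-].
  case: q => [t|t] /=; first by rewrite (wf _ _ _ wj) -xy.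
  (* Here [j] differs from [i], since [w i] is the removed [v]; so no vertex from [Gs i] has label
     [j]. *)
  apply/negbTE; apply: contraNneq yv => -[ij].
  by rewrite -ij wi in wj; case: wj => ->.
by move=> j js; apply: mal; rewrite in_cons js orbT.
Qed.

Theorem theorem3p7 (n : nat) (hn : 1 < n)
    (G0 : mgraph) (hG0conn : connected G0) (hG0 : PMH G0)
    (horder : #|vertex G0| = 2 * n)
    (u v : 'I_n -> vertex G0) (hu : injective u) (hv : injective v)
    (hbip : bipartition [set u i | i in 'I_n] [set v i | i in 'I_n])
    (I : {set 'I_n}) (hI : I \subset [set i | degree (v i) == 3])
    (Gs : 'I_n -> mgraph) (z : forall i, vertex (Gs i))
    (hGsconn : forall i, i \in I -> connected (Gs i))
    (hz : forall i, i \in I -> malleable 3 (z i))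
    (s : seq 'I_n) (hs : uniq s) (hsI : s =i I)
    (G : mgraph) (hG : star_products z (fun i => Some (v i)) s G) :
  PMH G.
Proof.
(* Initially [v i] has label [Some i], and the vertices of [U] have label [None]. *)
pose f x := [pick i | v i == x].
have fP x i : (f x == Some i) = (x == v i).
  rewrite /f; case: pickP => [j /eqP <-|/(_ i) vx]; last by rewrite [RHS]eq_sym vx.
  by rewrite (inj_eq hv).
apply: (star_products_PMH (f := f)) hG => //; last first.
- by move=> i; rewrite hsI; apply: hz.
- by move=> i x y [<-].
split=> [|i|e x y i j xe ye /eqP + /eqP].
- have -> : [set x | f x == None] = ~: [set v i | i in 'I_n].
    apply/setP => x; rewrite !inE; apply/eqP/negP => [fx /imsetP[i _ xv]|vx].
      by have := fP x i; rewrite fx xv eqxx.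
    case fx: (f x) => [i|] //; case: vx; apply/imsetP; exists i => //.
    by apply/eqP; rewrite -fP fx.
  by rewrite cardsCs setCK horder card_imset // card_ord mul2n -addnn addnK.
- have -> : [set x | f x == Some i] = [set v i] by apply/setP => x; rewrite !inE fP.
  by rewrite cards1.
rewrite !fP => /eqP xv /eqP yv; apply: hv; rewrite -xv -yv.
have [_ dis /(_ e)[p [q [pU _ eE]]]] := hbip.
(* The end [p] lies in [U], so [q] is the only labelled end of [e]. *)
have vq i' : v i' \in ends e -> v i' = q.
  rewrite eE !inE => /orP[]/eqP // vp.
  by have /pred0P/(_ p) := dis; rewrite /= pU -vp imset_f.
by rewrite xv yv in xe ye *; rewrite (vq _ xe) (vq _ ye).
Qed.
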